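(* Let $N$ be a positive integer and let $c_{ij}=g_{ij}/h_{ij}$ ($1\le i\le I$, $1\le j\le J$) be given conditional frequencies with $g_{ij}\ge 0$, $h_{ij}\ge 1$ relatively prime integers and $\sum_i c_{ij}=1$ for each $j$; let $m_j$ be the least common multiple of $h_{1j},\dots,h_{Ij}$. Suppose that the equation $\sum_{j=1}^J m_jx_j=N$ has $m$ positive integer solutions. Denote by $\mathfrak p_l$ the $[AB]$ marginal table corresponding to the $l$-th solution $(x^{(l)}_1,\dots,x^{(l)}_J)$, that is, $s_{ij+}=m_jx^{(l)}_jc_{ij}$, and by $\mathcal F_{AB}(\mathfrak p_l)$ the space of tables with that $[AB]$ marginal table. Then $$\mathcal F_{A|B}=\bigcup_{l=1}^{m}\mathcal F_{AB}(\mathfrak p_l),$$ and this union is disjoint.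
   Context: Let $X_1,\dots,X_r$ be categorical variables with finitely many levels each. Let $A,B$ be disjoint proper subsets of $\{X_1,\dots,X_r\}$ and let $C$ be the set of the remaining variables (possibly empty). Regard $A,B,C$ as three compound categorical variables with $I$, $J$, $K$ levels respectively ($K=1$ if $C=\emptyset$). An $r$-way contingency table is identified with a 3-way array $(s_{ijk})$ of nonnegative integers, $1\le i\le I$, $1\le j\le J$, $1\le k\le K$. A subscript $+$ denotes summation over that index. $\mathcal F_{A|B}$ is the set of all tables $(s_{ijk})$ of nonnegative integers with $\sum_{i,j,k}s_{ijk}=N$, $s_{+j+}>0$ for all $j$, and $s_{ij+}/s_{+j+}=c_{ij}$ for all $i,j$. For a nonnegative integer $I\times J$ array $\mathfrak p=(p_{ij})$, $\mathcal F_{AB}(\mathfrak p)$ is the set of all tables $(s_{ijk})$ of nonnegative integers with $s_{ij+}=p_{ij}$ for all $i,j$. *)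

(* Defs.v *)
From mathcomp Require Import all_boot all_order all_algebra.
From mathcomp Require Import boolp classical_sets functions.

Set Implicit Arguments.
Unset Strict Implicit.
Unset Printing Implicit Defensive.

Import GRing.Theory Num.Theory.

Local Open Scope classical_set_scope.
Local Open Scope ring_scope.

(* The compound variables A, B, C index the first, second and third
   coordinates; C empty corresponds to K = 1. *)
Definition table (I J K : nat) := {ffun 'I_I * 'I_J * 'I_K -> nat}.

Section Tables.
Variables I J K : nat.
Implicit Type s : table I J K.

Definition total s : nat :=
  (\sum_(i < I) \sum_(j < J) \sum_(k < K) s (i, j, k))%N.

Definition margAB s (i : 'I_I) (j : 'I_J) : nat := (\sum_(k < K) s (i, j, k))%N.

Definition margB s (j : 'I_J) : nat :=
  (\sum_(i < I) \sum_(k < K) s (i, j, k))%N.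

Definition F_cond (N : nat) (c : 'I_I -> 'I_J -> rat) : set (table I J K) :=
  [set s | [/\ total s = N,
               (forall j, (0 < margB s j)%N) &
               forall i j, (margAB s i j)%:R / (margB s j)%:R = c i j]].

Definition F_AB (p : 'M[nat]_(I, J)) : set (table I J K) :=
  [set s | forall i j, margAB s i j = p i j].

End Tables.

Definition col_lcm (I J : nat) (h : 'I_I -> 'I_J -> nat) (j : 'I_J) : nat :=
  \big[lcmn/1%N]_(i < I) h i j.

Definition pos_solutions (J : nat) (a : 'I_J -> nat) (N : nat) :
    set {ffun 'I_J -> nat} :=
  [set x | (forall j, (0 < x j)%N) /\ (\sum_(j < J) a j * x j)%N = N].

(* Main.v *)
Require Import Defs.
From mathcomp Require Import all_boot all_order all_algebra.
From mathcomp Require Import boolp classical_sets functions.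

(** A table with conditional frequencies [c] is determined up to its [AB]
margin by the [B] margin alone, since [margAB s i j = c i j * margB s j].  The
point is which [B] margins can occur.  As [c i j = g i j / h i j] is in lowest
terms and [margAB s i j] is an integer, [h i j] divides [margB s j] for every
[i], hence so does the lcm [m_j] of the column; so [margB s j = m_j * x_j] with
[x_j > 0], and adding up over [j] makes [x] a solution of [\sum_j m_j x_j = N]
([F_condP]).  Conversely, because the frequencies of a column add up to [1], a
table whose [AB] margin is [m_j * x_j * c i j] has [B] margin [m_j * x_j]
([margB_of_margAB]).  The [B] margin of a table therefore recovers [x], which
gives both the converse inclusion and disjointness. *)

Set Implicit Arguments.
Unset Strict Implicit.
Unset Printing Implicit Defensive.

Import GRing.Theory Num.Theory.

Local Open Scope classical_set_scope.
Local Open Scope ring_scope.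

Section Margins.
Variables I J K : nat.
Implicit Type s : table I J K.

Lemma margBE s j : margB s j = (\sum_(i < I) margAB s i j)%N.
Proof. by []. Qed.

Lemma totalE s : Defs.total s = (\sum_(j < J) margB s j)%N.
Proof. exact: exchange_big. Qed.

End Margins.

Section ColumnLcm.
Variables (I J : nat) (h : 'I_I -> 'I_J -> nat).

Lemma dvdn_col_lcm i j : (h i j %| col_lcm h j)%N.
Proof. exact: (biglcmn_sup i). Qed.

Lemma col_lcm_dvdn j n :
  (forall i, (h i j %| n)%N) -> (col_lcm h j %| n)%N.
Proof. by move=> hn; apply/dvdn_biglcmP => i _. Qed.

Lemma col_lcm_gt0 j : (forall i, (0 < h i j)%N) -> (0 < col_lcm h j)%N.
Proof.
move=> h0; rewrite /col_lcm; elim/big_ind: _ => // a b a0 b0.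
by rewrite lcmn_gt0 a0.
Qed.

End ColumnLcm.

Section ConditionalFrequencies.
Variables (I J K : nat) (c : 'I_I -> 'I_J -> rat) (g h : 'I_I -> 'I_J -> nat).
Hypothesis h_gt0 : forall i j, (0 < h i j)%N.
Hypothesis coprime_gh : forall i j, coprime (g i j) (h i j).
Hypothesis cE : forall i j, c i j = (g i j)%:R / (h i j)%:R.
Hypothesis sum_c : forall j, \sum_(i < I) c i j = 1.
Implicit Types (s : table I J K) (x : {ffun 'I_J -> nat}).

(** The integer [m_j * c i j]: dividing by [h i j] before multiplying by
[g i j] makes the truncated quotient exact. *)
Definition scaled_freq i j : nat := (col_lcm h j %/ h i j * g i j)%N.

Definition solution_margin x : 'M[nat]_(I, J) :=
  \matrix_(i, j) (scaled_freq i j * x j)%N.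

Lemma scaled_freqE i j : (scaled_freq i j)%:R = (col_lcm h j)%:R * c i j.
Proof.
have h0 : (h i j)%:R != 0 :> rat by rewrite pnatr_eq0 -lt0n.
rewrite cE /scaled_freq -{2}(divnK (dvdn_col_lcm h i j)) !natrM.
by rewrite -mulrA [_%:R * (_ / _)]mulrC divfK.
Qed.

Lemma sum_scaled_freq j : (\sum_(i < I) scaled_freq i j)%N = col_lcm h j.
Proof.
apply/eqP; rewrite -(eqr_nat rat) natr_sum.
under eq_bigr do rewrite scaled_freqE.
by rewrite -mulr_sumr sum_c mulr1.
Qed.

Lemma margB_of_margAB s x j : F_AB (K := K) (solution_margin x) s ->
  margB s j = (col_lcm h j * x j)%N.
Proof.
move=> sx; rewrite margBE -sum_scaled_freq big_distrl.
by apply: eq_bigr => i _; rewrite sx mxE.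
Qed.

Lemma F_AB_solution_inj s x y : F_AB (K := K) (solution_margin x) s ->
  F_AB (K := K) (solution_margin y) s -> x = y.
Proof.
move=> sx sy; apply/ffunP => j; apply/eqP.
have m0 : (0 < col_lcm h j)%N by apply: col_lcm_gt0 => i.
by rewrite -(eqn_pmul2l m0) -(margB_of_margAB j sx) (margB_of_margAB j sy).
Qed.

(** Lowest terms enter here: [margAB s i j * h i j = g i j * margB s j] and
[h i j] is coprime to [g i j], so it must divide the other factor. *)
Lemma col_lcm_dvd_margB s j : (0 < margB s j)%N ->
  (forall i, (margAB s i j)%:R / (margB s j)%:R = c i j) ->
  (col_lcm h j %| margB s j)%N.
Proof.
move=> s0 sc; apply: col_lcm_dvdn => i.
have B0 : (margB s j)%:R != 0 :> rat by rewrite pnatr_eq0 -lt0n.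
have h0 : (h i j)%:R != 0 :> rat by rewrite pnatr_eq0 -lt0n.
have /eqP := sc i; rewrite cE eqr_div // -!natrM eqr_nat => /eqP eq_gh.
have cop : coprime (h i j) (g i j) by rewrite coprime_sym.
by rewrite -(Gauss_dvdr _ cop) -eq_gh dvdn_mull.
Qed.

Lemma F_condP N s :
  F_cond N c s <->
  exists2 x, pos_solutions (col_lcm h) N x & F_AB (K := K) (solution_margin x) s.
Proof.
split=> [[tot_s s0 sc] | [x [x0 sum_x] sx]].
  have m_dvd j : (col_lcm h j %| margB s j)%N.
    by apply: col_lcm_dvd_margB => // i.
  have xE j : (col_lcm h j * (margB s j %/ col_lcm h j))%N = margB s j.
    by rewrite mulnC divnK.
  exists [ffun j => margB s j %/ col_lcm h j]%N; first split=> [j|].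
  - by rewrite ffunE; have := s0 j; rewrite -{1}(xE j) muln_gt0 => /andP[].
  - by rewrite -tot_s totalE; apply: eq_bigr => j _; rewrite ffunE xE.
  move=> i j; apply/eqP; rewrite mxE ffunE -(eqr_nat rat) natrM scaled_freqE.
  by rewrite mulrAC -natrM xE -sc mulrC divfK // pnatr_eq0 -lt0n.
have B0 j : (0 < margB s j)%N.
  rewrite (margB_of_margAB j sx) muln_gt0 x0 andbT.
  by apply: col_lcm_gt0 => i.
split=> // [|i j].
  by rewrite totalE -sum_x; apply: eq_bigr => j _; rewrite (margB_of_margAB j sx).
apply: (canLR (mulfK _)); first by rewrite pnatr_eq0 -lt0n.
rewrite sx mxE natrM scaled_freqE (margB_of_margAB j sx) natrM.
by rewrite mulrAC mulrC.
Qed.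

End ConditionalFrequencies.

Theorem corollary2p3 (I J K : nat) (hI : (0 < I)%N) (hJ : (0 < J)%N)
    (hK : (0 < K)%N) (N : nat) (hN : (0 < N)%N)
    (c : 'I_I -> 'I_J -> rat) (g h : 'I_I -> 'I_J -> nat)
    (hh : forall i j, (1 <= h i j)%N)
    (hgh : forall i j, coprime (g i j) (h i j))
    (hc : forall i j, c i j = (g i j)%:R / (h i j)%:R)
    (hsum : forall j, \sum_(i < I) c i j = 1)
    (m : nat) (x : 'I_m -> {ffun 'I_J -> nat})
    (hx : set_bij [set: 'I_m] (pos_solutions (col_lcm h) N) x) :
  exists p : 'I_m -> 'M[nat]_(I, J),
    [/\ forall l i j, (p l i j)%:R = (col_lcm h j)%:R * (x l j)%:R * c i j,
        F_cond N c = \bigcup_(l in [set: 'I_m]) F_AB (K := K) (p l) &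
        trivIset [set: 'I_m] (fun l => F_AB (K := K) (p l))].
Proof.
have [x_sol x_inj x_surj] := hx.
have F_condP := F_condP (K := K) hh hgh hc hsum.
exists (fun l => solution_margin g h (x l)); split.
- by move=> l i j; rewrite mxE natrM (scaled_freqE hh hc) mulrAC.
- apply/seteqP; split=> [s /F_condP[y /x_surj[l _ <-] sy] | s [l _ sl]].
    by exists l.
  by apply/F_condP; exists (x l) => //; apply: x_sol.
- move=> l l' _ _ [s [sl sl']]; apply: x_inj; rewrite ?in_setT //.
  exact: (F_AB_solution_inj hh hc hsum sl sl').
Qed.
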